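(* The class of quasi neighborhood balanced colored graphs is not hereditary; that is, it is not true that every induced subgraph of every quasi neighborhood balanced colored graph is again a quasi neighborhood balanced colored graph.
   Context: All graphs are finite and simple, with nonempty vertex set; $N(v)$ denotes the open neighborhood of a vertex $v$. A quasi neighborhood balanced coloring of a graph $G$ is a coloring of its vertices with two colors, $c:V(G)\to\{\text{red},\text{blue}\}$, such that for every vertex $v$ the number of red vertices in $N(v)$ and the number of blue vertices in $N(v)$ differ by at most one, and for at least one vertex this difference is exactly one. A graph admitting such a coloring is called a quasi neighborhood balanced colored graph. A family $\mathcal{F}$ of graphs is hereditary if each induced subgraph of every graph in $\mathcal{F}$ is also in $\mathcal{F}$. *)

(* Defs.v *)
From mathcomp Require Import all_boot.
From mathcomp Require Import ssrint.

Set Implicit Arguments.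
Unset Strict Implicit.
Unset Printing Implicit Defensive.

Record graph := Graph {
  vertex :> finType;
  adj : rel vertex;
  adj_sym : symmetric adj;
  adj_irrefl : irreflexive adj;
  vertex_nonempty : 0 < #|vertex|
}.

Definition open_nbhd (G : graph) (v : G) : {set G} := [set w | adj v w].

Definition induced_adj (G : graph) (S : {set G}) : rel {x : G | x \in S} :=
  fun x y => adj (val x) (val y).

Lemma induced_adj_sym (G : graph) (S : {set G}) : symmetric (@induced_adj G S).
Proof. by move=> x y; apply: adj_sym. Qed.

Lemma induced_adj_irrefl (G : graph) (S : {set G}) :
  irreflexive (@induced_adj G S).
Proof. by move=> x; apply: adj_irrefl. Qed.

Lemma induced_nonempty (G : graph) (S : {set G}) :
  S != set0 -> 0 < #|{: {x : G | x \in S}}|.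
Proof. by rewrite card_sig card_gt0. Qed.

Definition induced_subgraph (G : graph) (S : {set G}) (S_nonempty : S != set0) :
    graph :=
  Graph (@induced_adj_sym G S) (@induced_adj_irrefl G S)
        (induced_nonempty S_nonempty).

Definition hereditary (F : graph -> Prop) : Prop :=
  forall G : graph, F G ->
  forall (S : {set G}) (S_nonempty : S != set0),
    F (induced_subgraph S_nonempty).

Definition color := bool.
Definition red : color := true.
Definition blue : color := false.

Definition color_count (G : graph) (c : G -> color) (a : color) (v : G) : nat :=
  #|[set w in open_nbhd v | c w == a]|.

(* The subtraction is the one of integers, so this is an absolute difference. *)
Definition color_diff (G : graph) (c : G -> color) (v : G) : nat :=
  `|color_count c red v - color_count c blue v|%N.

Definition quasi_nb_coloring (G : graph) (c : G -> color) : Prop :=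
  (forall v : G, color_diff c v <= 1) /\ (exists v : G, color_diff c v = 1).

Definition quasi_nb_colored (G : graph) : Prop :=
  exists c : G -> color, quasi_nb_coloring c.

(* Main.v *)
From mathcomp Require Import all_boot.
Require Import Defs.

(** A quasi neighborhood balanced coloring must have a vertex where the two
    colors are out of balance by exactly one, and such a vertex has a neighbor.
    Hence no edgeless graph admits one ([edgeless_not_quasi_nb_colored]).  A
    single vertex of any graph induces an edgeless subgraph, so a hereditary
    class of quasi neighborhood balanced colored graphs would have to be empty;
    but it contains the complete graph on two vertices
    ([complete_graph2_quasi_nb_colored]), where each vertex has exactly one
    neighbor. *)

Lemma edgeless_not_quasi_nb_colored (G : graph) :
  (forall x y : G, ~~ adj x y) -> ~ quasi_nb_colored G.
Proof.
move=> noE [c [_ [v]]].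
have count0 a : color_count c a v = 0.
  apply: eq_card0 => w.
  by rewrite !inE (negbTE (noE v w)).
by rewrite /color_diff !count0.
Qed.

Definition complete_adj2 : rel bool := fun x y => x != y.

Lemma complete_adj2_sym : symmetric complete_adj2.
Proof. by case; case. Qed.

Lemma complete_adj2_irrefl : irreflexive complete_adj2.
Proof. by case. Qed.

Lemma card_bool_gt0 : 0 < #|{: bool}|.
Proof. by rewrite card_bool. Qed.

Definition complete_graph2 : graph :=
  Graph complete_adj2_sym complete_adj2_irrefl card_bool_gt0.

(** With one neighbor at each vertex, the two color counts are 0 and 1 in some
    order whatever the coloring is. *)
Lemma color_diff_complete_graph2 (c : complete_graph2 -> color)
    (v : complete_graph2) : color_diff c v = 1.
Proof.
have countE a : color_count c a v = (c (~~ v) == a).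
  rewrite /color_count.
  have -> : [set w in open_nbhd v | c w == a]
            = [set w in [set ~~ v : complete_graph2] | c w == a].
    by apply/setP => w; rewrite !inE /=; congr andb; case: v w => [] [].
  case: eqP => [ca | /eqP ca].
    rewrite -[RHS](cards1 (~~ v : complete_graph2)); apply: eq_card => w.
    by rewrite !inE; case: eqP => [-> | //]; rewrite ca eqxx.
  apply: eq_card0 => w.
  by rewrite !inE; case: eqP => [-> | //]; rewrite (negbTE ca).
by rewrite /color_diff !countE; case: (c _).
Qed.

Lemma complete_graph2_quasi_nb_colored : quasi_nb_colored complete_graph2.
Proof.
exists (fun=> red); split; last exists true.
  by move=> v; rewrite color_diff_complete_graph2.
exact: color_diff_complete_graph2.
Qed.

Theorem theorem2p20 : ~ hereditary quasi_nb_colored.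
Proof.
move=> her.
have S_nonempty : [set true : complete_graph2] != set0.
  by apply/set0Pn; exists true; rewrite inE.
apply: edgeless_not_quasi_nb_colored
  (her _ complete_graph2_quasi_nb_colored _ S_nonempty).
by move=> [x xS] [y yS]; move: xS yS; rewrite /= /induced_adj !inE /= => /eqP-> /eqP->.
Qed.
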